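(* Let $a,b,c,d,e,h\in\mathbb C$ and consider, on the two-mode bosonic Fock space, the operators $$\hat S^+=a\,\hat a_1^\dagger\hat a_2+c\,(\hat a_1^\dagger)^2+d\,\hat a_2^2,\qquad \hat S^-=b\,\hat a_2^\dagger\hat a_1+e\,\hat a_1^2+h\,(\hat a_2^\dagger)^2,\qquad \hat S^z=\frac{\hat n_1-\hat n_2}{2}.$$ Then the commutation relations $$[\hat S^z,\hat S^\pm]=\pm\hat S^\pm,\qquad[\hat S^+,\hat S^-]=2\hat S^z$$ hold if and only if $$ah=bc,\qquad bd=ae,\qquad ce=dh,\qquad ab-4ce=1 .$$
   Context: The two-mode Fock space has basis $\{|n_1,n_2\rangle:(n_1,n_2)\in\mathbb N_0^2\}$; the operators act on finite linear combinations of basis vectors by $\hat a_1|n_1,n_2\rangle=\sqrt{n_1}|n_1-1,n_2\rangle$, $\hat a_1^\dagger|n_1,n_2\rangle=\sqrt{n_1+1}|n_1+1,n_2\rangle$, and similarly for $\hat a_2,\hat a_2^\dagger$ acting on $n_2$; $\hat n_i=\hat a_i^\dagger\hat a_i$. *)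

(* Defs.v *)
From HB Require Import structures.
From mathcomp Require Import all_boot all_order all_algebra.
From mathcomp Require Import finmap monalg complex reals.

Set Implicit Arguments.
Unset Strict Implicit.
Unset Printing Implicit Defensive.

Import Order.TTheory GRing.Theory Num.Theory.
Local Open Scope ring_scope.
Local Open Scope complex_scope.

(* Finite linear combinations of the kets |n1,n2>: the algebraic (uncompleted)
   Fock space. *)
Definition fock (R : realType) := {malg R[i][(nat * nat)%type]}.

HB.instance Definition _ (R : realType) :=
  GRing.Lmodule.copy (fock R) {malg R[i][(nat * nat)%type]}.

Definition ket {R : realType} (n1 n2 : nat) : fock R := << (n1, n2) >>.

(* Linear extension of a map given on kets. *)
Definition linext {R : realType} (f : nat -> nat -> fock R) (v : fock R)
    : fock R :=
  \sum_(k <- msupp v) v@_k *: f k.1 k.2.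

Lemma linextEw {R : realType} (f : nat -> nat -> fock R) (v : fock R)
    (D : {fset (nat * nat)%type}) :
  (msupp v `<=` D)%fset -> linext f v = \sum_(k <- D) v@_k *: f k.1 k.2.
Proof.
move=> le; rewrite /linext (big_fset_incl _ le) //= => k _ kv.
by rewrite mcoeff_outdom // scale0r.
Qed.

Fact linext_is_linear {R : realType} (f : nat -> nat -> fock R) :
  linear (linext f).
Proof.
move=> x u v.
pose D := (msupp (x *: u + v) `|` (msupp u `|` msupp v))%fset.
rewrite (@linextEw _ f _ D); last exact: fsubsetUl.
rewrite (@linextEw _ f u D); last first.
  by rewrite /D fsetUCA; exact: fsubsetUl.
rewrite (@linextEw _ f v D); last first.
  by rewrite /D fsetUA; exact: fsubsetUr.
rewrite scaler_sumr -big_split /=; apply: eq_bigr => k _.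
by rewrite mcoeffD mcoeffZ scalerDl scalerA.
Qed.

HB.instance Definition _ (R : realType) (f : nat -> nat -> fock R) :=
  GRing.isLinear.Build R[i] (fock R) (fock R) *:%R (linext f)
    (linext_is_linear f).

Lemma linext_ket {R : realType} (f : nat -> nat -> fock R) (n1 n2 : nat) :
  linext f (ket n1 n2) = f n1 n2.
Proof.
rewrite (@linextEw _ f _ [fset (n1, n2)]%fset); last exact: msuppU_le.
by rewrite big_seq_fset1 mcoeffU eqxx scale1r.
Qed.

Definition csqrt {R : realType} (n : nat) : R[i] := (Num.sqrt (n%:R : R))%:C.

(* On a vacuum mode [0.-1 = 0], but the coefficient [csqrt 0 = 0] makes the
   annihilation operators vanish there. *)
Definition ann1 {R : realType} : fock R -> fock R :=
  linext (fun n1 n2 => csqrt n1 *: ket n1.-1 n2).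
Definition ann2 {R : realType} : fock R -> fock R :=
  linext (fun n1 n2 => csqrt n2 *: ket n1 n2.-1).
Definition cre1 {R : realType} : fock R -> fock R :=
  linext (fun n1 n2 => csqrt n1.+1 *: ket n1.+1 n2).
Definition cre2 {R : realType} : fock R -> fock R :=
  linext (fun n1 n2 => csqrt n2.+1 *: ket n1 n2.+1).

HB.instance Definition _ (R : realType) := GRing.Linear.on (@ann1 R).
HB.instance Definition _ (R : realType) := GRing.Linear.on (@ann2 R).
HB.instance Definition _ (R : realType) := GRing.Linear.on (@cre1 R).
HB.instance Definition _ (R : realType) := GRing.Linear.on (@cre2 R).

Lemma ann1_ket {R : realType} (n1 n2 : nat) :
  ann1 (ket n1 n2) = csqrt n1 *: ket n1.-1 n2 :> fock R.
Proof. exact: linext_ket. Qed.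

Lemma ann2_ket {R : realType} (n1 n2 : nat) :
  ann2 (ket n1 n2) = csqrt n2 *: ket n1 n2.-1 :> fock R.
Proof. exact: linext_ket. Qed.

Lemma cre1_ket {R : realType} (n1 n2 : nat) :
  cre1 (ket n1 n2) = csqrt n1.+1 *: ket n1.+1 n2 :> fock R.
Proof. exact: linext_ket. Qed.

Lemma cre2_ket {R : realType} (n1 n2 : nat) :
  cre2 (ket n1 n2) = csqrt n2.+1 *: ket n1 n2.+1 :> fock R.
Proof. exact: linext_ket. Qed.

Definition num1 {R : realType} : fock R -> fock R := cre1 \o ann1.
Definition num2 {R : realType} : fock R -> fock R := cre2 \o ann2.

HB.instance Definition _ (R : realType) := GRing.Linear.on (@num1 R).
HB.instance Definition _ (R : realType) := GRing.Linear.on (@num2 R).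

Definition commutator {R : realType} (A B : fock R -> fock R)
    : fock R -> fock R :=
  (A \o B) \- (B \o A).

Definition Splus {R : realType} (a c d : R[i]) : fock R -> fock R :=
  (a \*: (cre1 \o ann2)) \+ (c \*: (cre1 \o cre1)) \+ (d \*: (ann2 \o ann2)).

Definition Sminus {R : realType} (b e h : R[i]) : fock R -> fock R :=
  (b \*: (cre2 \o ann1)) \+ (e \*: (ann1 \o ann1)) \+ (h \*: (cre2 \o cre2)).

Definition Sz {R : realType} : fock R -> fock R :=
  2^-1 \*: (num1 \- num2).

HB.instance Definition _ (R : realType) (a c d : R[i]) :=
  GRing.Linear.on (Splus a c d).
HB.instance Definition _ (R : realType) (b e h : R[i]) :=
  GRing.Linear.on (Sminus b e h).
HB.instance Definition _ (R : realType) := GRing.Linear.on (@Sz R).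

(* Main.v *)
From HB Require Import structures.
Require Import Defs.
From mathcomp Require Import all_boot all_order all_algebra.
From mathcomp Require Import monalg complex reals ring.

Import GRing.Theory Num.Theory.
Local Open Scope ring_scope.
Local Open Scope complex_scope.

(** The relations with S^z hold for all parameters.  Normal ordering gives
    [S^+, S^-] = (ab - 4ce) n1 - (ab - 4dh) n2 + 2 (ah - bc) a1^+ a2^+
                 + 2 (bd - ae) a1 a2 + 2 (dh - ce),
    and the normally ordered monomials are separated by their values on the
    kets |0,0>, |1,0> and |1,1>. *)

(* The operators are kept abstract: unfolding the concrete ones makes
   rewriting with the commutation relations intractable. *)
Section CanonicalCommutationRelations.
Variables (K : numFieldType) (V : lmodType K).
(* Linear forms separating points reduce identities in [V] to scalar ones,
   within reach of [ring] and [field]. *)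
Variables (T : Type) (coef : T -> {linear V -> K^o}).
Hypothesis coef_inj : forall u v, (forall k, coef k u = coef k v) -> u = v.
Variables a1 a2 c1 c2 : {linear V -> V}.
Hypothesis a1c1 : forall v, a1 (c1 v) = c1 (a1 v) + v.
Hypothesis a2c2 : forall v, a2 (c2 v) = c2 (a2 v) + v.
Hypothesis a1c2 : forall v, a1 (c2 v) = c2 (a1 v).
Hypothesis a2c1 : forall v, a2 (c1 v) = c1 (a2 v).
Hypothesis a2a1 : forall v, a2 (a1 v) = a1 (a2 v).
Hypothesis c2c1 : forall v, c2 (c1 v) = c1 (c2 v).

Local Notation raising a c d v :=
  (a *: c1 (a2 v) + c *: c1 (c1 v) + d *: a2 (a2 v)).
Local Notation lowering b e h v :=
  (b *: c2 (a1 v) + e *: a1 (a1 v) + h *: c2 (c2 v)).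
Local Notation weight v := (2^-1 *: (c1 (a1 v) - c2 (a2 v))).

(** Oriented to move creators left of annihilators, and mode 1 left of mode 2 within each kind, so
    every word reaches one normal form. *)
Let normal_order := (a1c1, a2c2, a1c2, a2c1, a2a1, c2c1).
Let additivity := (linearD a1, linearD a2, linearD c1, linearD c2,
  linearN a1, linearN a2, linearN c1, linearN c2).
Let homogeneity := (linearZZ a1, linearZZ a2, linearZZ c1, linearZZ c2).
Let coef_linear k :=
  (linearD (coef k), linearN (coef k), linearZZ (coef k)).
Let nz2 : 2 != 0 :> K.
Proof. by rewrite pnatr_eq0. Qed.

Lemma weight_raising a c d v :
  weight (raising a c d v) - raising a c d (weight v) = raising a c d v.
Proof.
rewrite !(additivity, homogeneity, normal_order).
(* Unfolding [GRing.scale] turns the scaling of [K^o] into multiplication; the factor 1/2 calls for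
   [field]. *)
by apply: coef_inj => k; rewrite !coef_linear /GRing.scale /=; field.
Qed.

Lemma weight_lowering b e h v :
  weight (lowering b e h v) - lowering b e h (weight v) = - lowering b e h v.
Proof.
rewrite !(additivity, homogeneity, normal_order).
by apply: coef_inj => k; rewrite !coef_linear /GRing.scale /=; field.
Qed.

(** In each mode the squares satisfy [a^2, (a^+)^2] = 4 n + 2, the source of the factors 4 and of
    the scalar term. *)
Lemma raising_lowering a b c d e h v :
  raising a c d (lowering b e h v) - lowering b e h (raising a c d v) =
    (a * b - 4 * c * e) *: c1 (a1 v) - (a * b - 4 * d * h) *: c2 (a2 v)
    + (2 * (a * h - b * c)) *: c1 (c2 v)
    + (2 * (b * d - a * e)) *: a1 (a2 v)
    + (2 * (d * h - c * e)) *: v.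
Proof.
rewrite !(additivity, homogeneity, normal_order).
by apply: coef_inj => k; rewrite !coef_linear /GRing.scale /=; ring.
Qed.

Lemma raising_lowering_weight a b c d e h v :
  a * h = b * c -> b * d = a * e -> c * e = d * h -> a * b - 4 * c * e = 1 ->
  raising a c d (lowering b e h v) - lowering b e h (raising a c d v) =
    2 *: weight v.
Proof.
(* Replacing dh by ce makes the coefficients of both number operators equal to ab - 4ce = 1. *)
move=> ah bd ce ab; rewrite raising_lowering ah bd -[4 * d * h]mulrA -ce mulrA.
by rewrite ab !subrr mulr0 !scale0r !addr0 !scale1r scalerA divff // scale1r.
Qed.

(** For the converse: each choice of [v] and [k] yields a scalar equation linear in the combinations
    of parameters to be determined. *)
Lemma coef_raising_lowering a b c d e h v k :
  raising a c d (lowering b e h v) - lowering b e h (raising a c d v) =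
    2 *: weight v ->
  (a * b - 4 * c * e - 1) * coef k (c1 (a1 v))
    - (a * b - 4 * d * h - 1) * coef k (c2 (a2 v))
    + 2 * (a * h - b * c) * coef k (c1 (c2 v))
    + 2 * (b * d - a * e) * coef k (a1 (a2 v))
    + 2 * (d * h - c * e) * coef k v = 0.
Proof.
rewrite raising_lowering scalerA divff // scale1r => /(congr1 (coef k)).
rewrite !coef_linear /GRing.scale /= => /eqP; rewrite -subr_eq0 => /eqP <-.
by ring.
Qed.

End CanonicalCommutationRelations.

(** * Canonical commutation relations on the Fock space *)

Section Fock.
Variable R : realType.
Implicit Types (v : fock R) (a b c d e h x : R[i]).

Lemma fock_ket_ext (f g : {linear fock R -> fock R}) :
  (forall n1 n2, f (ket n1 n2) = g (ket n1 n2)) -> f =1 g.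
Proof.
move=> fg v; rewrite (monalgE v) !linear_sum; apply: eq_bigr => -[n1 n2] _.
have -> : << v@_(n1, n2) *g (n1, n2) >> = v@_(n1, n2) *: (ket n1 n2 : fock R).
  by apply/malgP => k; rewrite mcoeffZ !mcoeffU mulrnAr mulr1.
by rewrite !linearZ fg.
Qed.

Lemma csqrtK n : csqrt n * csqrt n = n%:R :> R[i].
Proof.
by rewrite /csqrt -rmorphM /= -expr2 sqr_sqrtr ?ler0n // rmorph_nat.
Qed.

Lemma csqrt1 : csqrt 1 = 1 :> R[i].
Proof. by rewrite /csqrt sqrtr1. Qed.

Lemma csqrt0 : csqrt 0 = 0 :> R[i].
Proof. by rewrite /csqrt sqrtr0. Qed.

Let ketE := (@ann1_ket R, @ann2_ket R, @cre1_ket R, @cre2_ket R).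

Lemma ann1_cre1 v : ann1 (cre1 v) = cre1 (ann1 v) + v.
Proof.
(* The vacuum of mode 1 is treated apart, since the truncated predecessor is not undone by the
   successor there; [csqrt 0] removes that term. *)
apply: (fock_ket_ext (ann1 \o cre1) ((cre1 \o ann1) \+ idfun)) => -[|n1] n2 /=;
  rewrite !ketE !linearZ /= !ketE !scalerA /= !csqrtK.
  by rewrite csqrt0 mul0r scale0r add0r scale1r.
by rewrite -[X in _ + X]scale1r -scalerDl -natr1.
Qed.

Lemma ann2_cre2 v : ann2 (cre2 v) = cre2 (ann2 v) + v.
Proof.
apply: (fock_ket_ext (ann2 \o cre2) ((cre2 \o ann2) \+ idfun)) => n1 [|n2] /=;
  rewrite !ketE !linearZ /= !ketE !scalerA /= !csqrtK.
  by rewrite csqrt0 mul0r scale0r add0r scale1r.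
by rewrite -[X in _ + X]scale1r -scalerDl -natr1.
Qed.

Lemma ann2_ann1 v : ann2 (ann1 v) = ann1 (ann2 v).
Proof.
apply: (fock_ket_ext (ann2 \o ann1) (ann1 \o ann2)) => n1 n2 /=.
by rewrite !ketE !linearZ /= !ketE !scalerA mulrC.
Qed.

Lemma cre2_cre1 v : cre2 (cre1 v) = cre1 (cre2 v).
Proof.
apply: (fock_ket_ext (cre2 \o cre1) (cre1 \o cre2)) => n1 n2 /=.
by rewrite !ketE !linearZ /= !ketE !scalerA mulrC.
Qed.

Lemma ann1_cre2 v : ann1 (cre2 v) = cre2 (ann1 v).
Proof.
apply: (fock_ket_ext (ann1 \o cre2) (cre2 \o ann1)) => n1 n2 /=.
by rewrite !ketE !linearZ /= !ketE !scalerA mulrC.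
Qed.

Lemma ann2_cre1 v : ann2 (cre1 v) = cre1 (ann2 v).
Proof.
apply: (fock_ket_ext (ann2 \o cre1) (cre1 \o ann2)) => n1 n2 /=.
by rewrite !ketE !linearZ /= !ketE !scalerA mulrC.
Qed.

(** The target [R[i]^o] is the field as a module over itself, so that coefficients are the
    separating linear forms required above. *)
Definition coef (k : nat * nat) v : R[i]^o := v@_k.

Fact coef_is_linear k : linear (coef k).
Proof. by move=> x u v; rewrite /coef mcoeffD mcoeffZ. Qed.

HB.instance Definition _ k :=
  GRing.isLinear.Build R[i] (fock R) R[i]^o *:%R (coef k) (coef_is_linear k).

Lemma coef_inj u v : (forall k, coef k u = coef k v) -> u = v.
Proof. by move=> uv; apply/malgP. Qed.

Lemma commutator_Sz_Splus a c d : commutator Sz (Splus a c d) =1 Splus a c d.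
Proof.
exact: (weight_raising R[i] (fock R) _ (fun k => coef k) coef_inj
  ann1 ann2 cre1 cre2 ann1_cre1 ann2_cre2 ann2_cre1 ann2_ann1
  cre2_cre1).
Qed.

Lemma commutator_Sz_Sminus b e h :
  commutator Sz (Sminus b e h) =1 \- Sminus b e h.
Proof.
exact: (weight_lowering R[i] (fock R) _ (fun k => coef k) coef_inj
  ann1 ann2 cre1 cre2 ann1_cre1 ann2_cre2 ann1_cre2 ann2_ann1
  cre2_cre1).
Qed.

Lemma commutator_Splus_Sminus a b c d e h :
  a * h = b * c -> b * d = a * e -> c * e = d * h -> a * b - 4 * c * e = 1 ->
  commutator (Splus a c d) (Sminus b e h) =1 2 \*: Sz.
Proof.
move=> ah bd ce ab v.
exact: (raising_lowering_weight R[i] (fock R) _ (fun k => coef k) coef_inj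
  ann1 ann2 cre1 cre2 ann1_cre1 ann2_cre2 ann2_ann1 cre2_cre1).
Qed.

Lemma coef_commutator_Splus_Sminus a b c d e h v k :
  commutator (Splus a c d) (Sminus b e h) v = 2 *: Sz v ->
  (a * b - 4 * c * e - 1) * coef k (cre1 (ann1 v))
    - (a * b - 4 * d * h - 1) * coef k (cre2 (ann2 v))
    + 2 * (a * h - b * c) * coef k (cre1 (cre2 v))
    + 2 * (b * d - a * e) * coef k (ann1 (ann2 v))
    + 2 * (d * h - c * e) * coef k v = 0.
Proof.
exact: (coef_raising_lowering R[i] (fock R) _ (fun k => coef k) coef_inj
  ann1 ann2 cre1 cre2 ann1_cre1 ann2_cre2 ann2_ann1 cre2_cre1).
Qed.

(** * Matrix elements between kets *)

Lemma coef_ketZ x n1 n2 m1 m2 :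
  coef (m1, m2) (x *: ket n1 n2) = x *+ ((n1 == m1) && (n2 == m2)).
Proof. by rewrite /coef mcoeffZ mcoeffU mulrnAr mulr1 xpair_eqE. Qed.

Lemma coef_ket n1 n2 m1 m2 :
  coef (m1, m2) (ket n1 n2) = ((n1 == m1) && (n2 == m2))%:R.
Proof. by rewrite -[ket n1 n2]scale1r coef_ketZ. Qed.

Lemma coef_ann1_ann2 n1 n2 m1 m2 :
  coef (m1, m2) (ann1 (ann2 (ket n1 n2))) =
    csqrt n2 * csqrt n1 *+ ((n1.-1 == m1) && (n2.-1 == m2)).
Proof. by rewrite ann2_ket linearZ /= ann1_ket scalerA coef_ketZ. Qed.

Lemma coef_cre1_cre2 n1 n2 m1 m2 :
  coef (m1, m2) (cre1 (cre2 (ket n1 n2))) =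
    csqrt n2.+1 * csqrt n1.+1 *+ ((n1.+1 == m1) && (n2.+1 == m2)).
Proof. by rewrite cre2_ket linearZ /= cre1_ket scalerA coef_ketZ. Qed.

Lemma coef_cre1_ann1 n1 n2 m1 m2 :
  coef (m1, m2) (cre1 (ann1 (ket n1 n2))) =
    n1%:R *+ ((n1 == m1) && (n2 == m2)).
Proof.
rewrite ann1_ket linearZ /= cre1_ket scalerA coef_ketZ.
(* For [n1 = 0] the resulting ket is |1,n2>, but with factor [csqrt 0]. *)
by case: n1 => [|n1]; rewrite ?csqrtK // csqrt0 mul0r !mul0rn.
Qed.

Lemma coef_cre2_ann2 n1 n2 m1 m2 :
  coef (m1, m2) (cre2 (ann2 (ket n1 n2))) =
    n2%:R *+ ((n1 == m1) && (n2 == m2)).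
Proof.
rewrite ann2_ket linearZ /= cre2_ket scalerA coef_ketZ.
by case: n2 => [|n2]; rewrite ?csqrtK // csqrt0 mul0r !mul0rn.
Qed.

Lemma coef_commutator_ket a b c d e h n1 n2 m1 m2 :
  let here := (n1 == m1) && (n2 == m2) in
  commutator (Splus a c d) (Sminus b e h) (ket n1 n2) = 2 *: Sz (ket n1 n2) ->
  (a * b - 4 * c * e - 1) * (n1%:R *+ here)
    - (a * b - 4 * d * h - 1) * (n2%:R *+ here)
    + 2 * (a * h - b * c) *
        (csqrt n2.+1 * csqrt n1.+1 *+ ((n1.+1 == m1) && (n2.+1 == m2)))
    + 2 * (b * d - a * e) *
        (csqrt n2 * csqrt n1 *+ ((n1.-1 == m1) && (n2.-1 == m2)))
    + 2 * (d * h - c * e) * here%:R = 0.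
Proof.
move=> here comm; rewrite /here -coef_ket -coef_cre1_ann1 -coef_cre2_ann2.
rewrite -coef_cre1_cre2 -coef_ann1_ann2; exact: coef_commutator_Splus_Sminus.
Qed.

End Fock.

Theorem theoremG1 (R : realType) (a b c d e h : R[i]) :
  [/\ commutator Sz (Splus a c d) =1 Splus a c d,
      commutator Sz (Sminus b e h) =1 \- Sminus b e h
    & commutator (Splus a c d) (Sminus b e h) =1 2 \*: Sz]
  <->
  [/\ a * h = b * c, b * d = a * e, c * e = d * h & a * b - 4 * c * e = 1].
Proof.
split=> [[_ _ comm]|[ah bd ce ab]]; last first.
  split; [exact: commutator_Sz_Splus | exact: commutator_Sz_Sminus |].
  exact: commutator_Splus_Sminus.
have comm_coef n1 n2 m1 m2 :=
  coef_commutator_ket R a b c d e h n1 n2 m1 m2 (comm (ket n1 n2)).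
have half x : 2 * x = 0 -> x = 0 :> R[i].
  by move/eqP; rewrite mulf_eq0 pnatr_eq0 => /eqP.
(* From |0,0> to |1,1> only ah - bc survives, and from |1,1> to |0,0> only bd - ae; the diagonal
   elements at |0,0> and |1,0> give the other two equations. *)
move: (comm_coef 0 0 0 0) (comm_coef 0 0 1 1)
  (comm_coef 1 1 0 0) (comm_coef 1 0 1 0).
rewrite /= !csqrt1 !mulr0n !mulr1n !mulr1 !mulr0 !subr0 ?subrr ?addr0 ?add0r.
move=> vac /half/subr0_eq ah /half/subr0_eq bd one.
(* The truncated predecessor leaves a pair annihilation term in [vac]; bd = ae cancels it. *)
move: vac one; rewrite bd subrr mulr0 mul0r add0r => vac.
rewrite vac addr0 => /subr0_eq ab.
by split=> //; move/half/subr0_eq: vac.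
Qed.
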